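(* If $\eta\leq0$, $L>-1$ and $0<\rho<x_{L,\eta,1}$, then the following Mitrinović–Adamović and Wilker type inequalities are valid: $$\left[\mathcal{F}_L(\eta,\rho)\right]^{L+\frac{3}{2}}<\left[\mathcal{F}_{L+1}(\eta,\rho)\right]^{L+\frac{5}{2}},$$ $$\left[\mathcal{F}_{L+1}(\eta,\rho)\right]^{\frac{1}{L+\frac{3}{2}}}+\frac{\mathcal{F}_{L+1}(\eta,\rho)}{\mathcal{F}_L(\eta,\rho)}\geq2.$$
   Context: For real $L>-1$, $\eta\in\mathbb{R}$, the regular Coulomb wave function is $$F_{L}(\eta,\rho)=C_{L}(\eta)\,\rho^{L+1}e^{-\mathrm{i}\rho}\,{}_1F_1(L+1-\mathrm{i}\eta,2L+2;2\mathrm{i}\rho),\qquad C_L(\eta)=\frac{2^Le^{-\pi\eta/2}\left|\Gamma(L+1+\mathrm{i}\eta)\right|}{\Gamma(2L+2)},$$ where ${}_1F_1$ is the Kummer confluent hypergeometric function. The normalized regular Coulomb wave function is $$\mathcal{F}_L(\eta,\rho)=C_L(\eta)^{-1}\rho^{-L-1}F_L(\eta,\rho)=\sum_{n\geq0}a_{L,n}\rho^n,$$ where $$a_{L,0}=1,\quad a_{L,1}=\frac{\eta}{L+1},\quad a_{L,n}=\frac{2\eta a_{L,n-1}-a_{L,n-2}}{n(n+2L+1)}\ \ (n\ge 2).$$ $x_{L,\eta,1}$ denotes the smallest positive zero of $\rho\mapsto F_L(\eta,\rho)$. *)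

(* Defs.v *)
From Stdlib Require Import Reals Factorial.
From Coquelicot Require Import Coquelicot.
Open Scope R_scope.

Definition Cexp (z : C) : C :=
  (exp (Re z) * cos (Im z), exp (Re z) * sin (Im z)).

(** Limits and sums of complex sequences are taken componentwise, through
    Coquelicot's total real operators. *)
Definition CLim_seq (u : nat -> C) : C :=
  (real (Lim_seq (fun n => Re (u n))), real (Lim_seq (fun n => Im (u n)))).

Definition CSeries (u : nat -> C) : C :=
  (Series (fun n => Re (u n)), Series (fun n => Im (u n))).

(** Rising factorial: [Cpoch z n] is z (z+1) ... (z+n-1). *)
Fixpoint Cpoch (z : C) (n : nat) : C :=
  match n with
  | O => RtoC 1
  | S m => (Cpoch z m * (z + RtoC (INR m)))%C
  end.

(** Euler-Gauss limit n! n^z / (z (z+1) ... (z+n)), valid for every complex z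
    outside 0, -1, -2, ...; here n^z is exp (z ln n).  The term n = 0 is a
    dummy value ([ln 0 = 0]) without effect on the limit. *)
Definition CGamma (z : C) : C :=
  CLim_seq (fun n =>
    (RtoC (INR (fact n)) * Cexp (z * RtoC (ln (INR n))) / Cpoch z (S n))%C).

Definition hyp1F1 (a b z : C) : C :=
  CSeries (fun n => (Cpoch a n / Cpoch b n * z ^ n / RtoC (INR (fact n)))%C).

(** [CGamma] is real at the real point 2L+2. *)
Definition coulombC (L eta : R) : R :=
  Rpower 2 L * exp (- (PI * eta) / 2)
  * Cmod (CGamma (RtoC (L + 1) + Ci * RtoC eta)%C) / Re (CGamma (RtoC (2 * L + 2))).

(** For L > -1 and rho > 0 the complex number below has zero imaginary part, by
    Kummer's transformation 1F1(a, b; z) = e^z 1F1(b - a, b; -z); [Re] only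
    casts it to [R]. *)
Definition coulombF (L eta rho : R) : R :=
  Re (RtoC (coulombC L eta) * RtoC (Rpower rho (L + 1))
      * Cexp (- Ci * RtoC rho)
      * hyp1F1 (RtoC (L + 1) - Ci * RtoC eta) (RtoC (2 * L + 2))
               (RtoC 2 * Ci * RtoC rho))%C.

(** Meant for rho > 0, like [coulombF]. *)
Definition coulombFn (L eta rho : R) : R :=
  / coulombC L eta * Rpower rho (- L - 1) * coulombF L eta rho.

Definition smallest_positive_zero (f : R -> R) (x : R) : Prop :=
  0 < x /\ f x = 0 /\ (forall y : R, 0 < y -> f y = 0 -> x <= y).

(* Main.v *)
Require Import Defs.
From Stdlib Require Import Reals Factorial Lra Lia Psatz.
From Coquelicot Require Import Coquelicot.
Open Scope R_scope.

(** Write [g] and [h] for the normalized Coulomb functions of orders [L] and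
    [L + 1], and put [k = eta / (L + 1) <= 0], [m = 2L + 3 > 1].  They satisfy the
    contiguous relations
      [g' = k g - (1 + k^2) / m * x h]  and  [x h' = m (g - h) - k x h],
    with [g 0 = h 0 = 1].  On [0, x1) the function [g] is positive, and the second
    relation makes [h] positive as well.

    The first inequality says that [D = (m + 2) ln h - m ln g] is positive.
    Its derivative is [E / (x r)], where [r = h / g] and
      [E = m (m + 2) (1 - r) - 2 k (m + 1) x r + (1 + k^2) x^2 r^2].
    The ratio solves the Riccati equation
      [x r' = m (1 - r) - 2 k x r + (1 + k^2) / m * x^2 r^2],
    and by it the derivative of [E] is positive wherever [E = 0] and [x > 0]; this is
    where [k <= 0] enters.  As [E] vanishes at 0, it stays positive
    ([riccati_excess_pos]), hence so does [D] ([contiguous_log_ineq]).  The Wilker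
    type inequality follows: its two terms are [exp u] and [exp v] with
    [m (u + v) = D > 0].

    The contiguous relations are checked on the coefficients of the Kummer series,
    whose real and imaginary parts are everywhere convergent real power series
    ([is_derive_coulomb_lower], [Derive_coulomb_raise]).  Dividing [coulombF] by
    [coulombC] requires [coulombC <> 0], that is, that the Euler-Gauss limit
    converges to a nonzero number when the real part of [z] is positive
    ([CGamma_neq_0]): the terms of the sequence, and likewise their reciprocals,
    have consecutive ratios [1 + O(1 / (n (n + 1)))]. *)

(** * A comparison theorem for the contiguous system *)

(** A minimum principle: if [f] were nonpositive at [X], its minimum over
    [0, X] would be nonpositive and attained at a point of (0, X], where the
    left neighbours would take smaller values. *)
Lemma pos_of_derive_pos_where_nonpos (f : R -> R) (X : R) :
  0 < X -> 0 <= f 0 ->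
  (forall c, 0 <= c <= X -> continuity_pt f c) ->
  (forall p, 0 < p <= X -> f p <= 0 -> exists d, 0 < d /\ is_derive f p d) ->
  0 < f X.
Proof.
  intros HX H0 Hc Hd.
  destruct (Rlt_or_le 0 (f X)) as [|HfX]; [assumption|exfalso].
  (* A minimum at 0 has value 0 = f X, so X is then a minimum too. *)
  assert (Hmin : exists q, 0 < q <= X /\ f q <= 0 /\ forall c, 0 <= c <= X -> f q <= f c).
  { destruct (continuity_ab_min f 0 X (Rlt_le _ _ HX) Hc) as [p [Hp Hp2]].
    destruct (Rle_lt_or_eq_dec 0 p (proj1 Hp2)) as [Hp0|Hp0].
    - exists p. split; [lra|]. split; [|exact Hp].
      apply Rle_trans with (f X); [apply Hp; lra|exact HfX].
    - exists X. split; [lra|]. split; [exact HfX|].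
      intros c Hcc. specialize (Hp c Hcc). subst p. lra. }
  destruct Hmin as [q [Hq [Hfq Hm]]].
  destruct (Hd q Hq Hfq) as [d [Hd0 Hder]].
  apply is_derive_Reals in Hder.
  destruct (Hder d Hd0) as [[e He] Hlim]. simpl in Hlim.
  set (s := Rmin (e / 2) q).
  assert (Hs : 0 < s) by (unfold s; apply Rmin_glb_lt; lra).
  assert (Hse : s < e) by (apply Rle_lt_trans with (e / 2); [apply Rmin_l|lra]).
  assert (Hsq : s <= q) by apply Rmin_r.
  specialize (Hlim (- s)).
  assert (Ha : Rabs (- s) < e) by (rewrite Rabs_Ropp, Rabs_right; lra).
  specialize (Hlim ltac:(lra) Ha).
  apply Rabs_def2 in Hlim.
  assert (Hm' := Hm (q + - s) ltac:(lra)).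
  assert (Hq' : (f (q + - s) - f q) / - s <= 0).
  { replace ((f (q + - s) - f q) / - s) with (- ((f (q + - s) - f q) * / s)) by (field; lra).
    assert (0 <= (f (q + - s) - f q) * / s); [|lra].
    apply Rmult_le_pos; [lra|]. apply Rlt_le, Rinv_0_lt_compat, Hs. }
  lra.
Qed.

(** The quantity below vanishes at 0.  Writing it [E] and [s = x r], the Riccati
    equation gives [x E' = E (- m + x B) + P] with
    [B = (2 (1 + k^2) s - 2 k (m + 1)) / (m + 2) >= 0] and [P > 0], so that [E]
    cannot return to 0. *)
Lemma riccati_excess_pos (k m X : R) (r r' : R -> R) :
  k <= 0 -> 0 < m -> 0 < X -> r 0 = 1 ->
  (forall x, 0 <= x <= X -> is_derive r x (r' x)) ->
  (forall x, 0 <= x <= X -> 0 < r x) ->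
  (forall x, 0 <= x <= X ->
     x * r' x = m * (1 - r x) - 2 * k * x * r x + (1 + k ^ 2) / m * x ^ 2 * r x ^ 2) ->
  0 < m * (m + 2) * (1 - r X) - 2 * k * (m + 1) * X * r X
      + (1 + k ^ 2) * X ^ 2 * r X ^ 2.
Proof.
  intros Hk Hm HX Hr0 Hder Hpos Heq.
  assert (Hcr : forall c, 0 <= c <= X -> continuity_pt r c).
  { intros c Hc. apply derivable_continuous_pt. exists (r' c).
    apply is_derive_Reals, Hder, Hc. }
  destruct (continuity_ab_maj r 0 X (Rlt_le _ _ HX) Hcr) as [M [HM _]].
  set (E := fun x => m * (m + 2) * (1 - r x) - 2 * k * (m + 1) * x * r x
      + (1 + k ^ 2) * x ^ 2 * r x ^ 2).
  (* An upper bound of B on [0, X]; the factor exp (- K x) makes the coefficient of E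
     in the equation negative. *)
  set (K := (2 * (1 + k ^ 2) * X * r M - 2 * k * (m + 1)) / (m + 2)).
  set (E' := fun x => - m * (m + 2) * r' x - 2 * k * (m + 1) * (r x + x * r' x)
      + (1 + k ^ 2) * (2 * x * r x ^ 2 + 2 * x ^ 2 * r x * r' x)).
  assert (HE : forall x, 0 <= x <= X ->
     is_derive (fun y => exp (- K * y) * E y) x (exp (- K * x) * (E' x - K * E x))).
  { intros x Hx. unfold E. assert (Hd := Hder x Hx).
    auto_derive.
    - repeat split; auto; exists (r' x); exact Hd.
    - replace (Derive _ x) with (r' x) by (symmetry; apply is_derive_unique; exact Hd).
      unfold E'. ring. }
  change (0 < E X).
  assert (Hgoal : 0 < exp (- K * X) * E X).
  { apply (pos_of_derive_pos_where_nonpos (fun y => exp (- K * y) * E y)); [exact HX| | |].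
    - unfold E. rewrite Hr0. right. ring.
    - intros c Hc. apply derivable_continuous_pt.
      exists (exp (- K * c) * (E' c - K * E c)). apply is_derive_Reals, HE, Hc.
    - intros p Hp HEp.
      exists (exp (- K * p) * (E' p - K * E p)).
      assert (Hpx : 0 <= p <= X) by lra.
      split; [|apply HE, Hpx].
      apply Rmult_lt_0_compat; [apply exp_pos|].
      assert (HEp0 : E p <= 0).
      { destruct (Rle_or_lt (E p) 0) as [|Hc]; [assumption|].
        exfalso. assert (0 < exp (- K * p) * E p); [|lra].
        apply Rmult_lt_0_compat; [apply exp_pos|exact Hc]. }
      set (B := (2 * (1 + k ^ 2) * p * r p - 2 * k * (m + 1)) / (m + 2)).
      assert (HBK : B <= K).
      { unfold B, K. apply Rmult_le_compat_r; [apply Rlt_le, Rinv_0_lt_compat; lra|].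
        assert (HpM : p * r p <= X * r M).
        { apply Rmult_le_compat; [lra|apply Rlt_le, Hpos, Hpx|lra|apply HM, Hpx]. }
        assert (0 <= 1 + k ^ 2) by nra. nra. }
      (* The value of p r'(p) that the Riccati equation would give if E p were 0. *)
      set (w0 := (2 * (1 + k ^ 2) * (p * r p) ^ 2 - 2 * k * m * (p * r p)) / (m * (m + 2))).
      assert (Hs : 0 < p * r p) by (apply Rmult_lt_0_compat; [lra|apply Hpos, Hpx]).
      assert (HA : 0 < 1 + k ^ 2) by nra.
      assert (Hw0 : 0 < w0).
      { unfold w0. apply Rdiv_lt_0_compat; [|nra].
        assert (0 < (1 + k ^ 2) * (p * r p) ^ 2) by (apply Rmult_lt_0_compat; [exact HA|nra]).
        assert (0 <= - k * m * (p * r p)); [|lra].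
        apply Rmult_le_pos; [nra|lra]. }
      assert (HB : 0 <= B).
      { unfold B. apply Rmult_le_pos; [|apply Rlt_le, Rinv_0_lt_compat; lra].
        assert (0 <= (1 + k ^ 2) * (p * r p)) by (apply Rmult_le_pos; lra).
        nra. }
      assert (Hid : p * (E' p - K * E p)
        = E p * (- m + p * (B - K)) + (- 2 * k * (p * r p) + (m + 2) * B * p * w0)).
      { assert (Hw := Heq p Hpx).
        assert (Hr' : r' p = (m * (1 - r p) - 2 * k * p * r p
                    + (1 + k ^ 2) / m * p ^ 2 * r p ^ 2) / p).
        { rewrite <- Hw. field. lra. }
        unfold E', E, B, w0. rewrite Hr'. field. split; lra. }
      assert (Hpos2 : 0 <= E p * (- m + p * (B - K))).
      { assert (0 <= p * (K - B)) by (apply Rmult_le_pos; lra).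
        assert (0 <= (- E p) * (m + p * (K - B))) by (apply Rmult_le_pos; lra).
        lra. }
      assert (0 < - 2 * k * (p * r p) + (m + 2) * B * p * w0).
      { unfold B.
        replace ((m + 2) * ((2 * (1 + k ^ 2) * p * r p - 2 * k * (m + 1)) / (m + 2)) * p * w0)
          with ((2 * (1 + k ^ 2) * (p * r p) + 2 * (- k) * (m + 1)) * (p * w0))
          by (field; lra).
        assert (0 < 2 * (1 + k ^ 2) * (p * r p)) by (apply Rmult_lt_0_compat; lra).
        assert (0 <= 2 * (- k) * (m + 1)) by (apply Rmult_le_pos; lra).
        assert (0 < p * w0) by (apply Rmult_lt_0_compat; lra).
        assert (0 <= - k * (p * r p)) by (apply Rmult_le_pos; lra).
        assert (0 < (2 * (1 + k ^ 2) * (p * r p) + 2 * - k * (m + 1)) * (p * w0))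
          by (apply Rmult_lt_0_compat; lra).
        lra. }
      assert (Hf : 0 < p * (E' p - K * E p)) by lra.
      apply Rmult_lt_reg_l with p; lra. }
  apply Rmult_lt_reg_l with (exp (- K * X)); [apply exp_pos|]. lra.
Qed.

(** The comparison behind the Mitrinovic-Adamovic inequality, for any pair of
    functions linked by the two contiguous relations of the Coulomb functions:
    [(m + 2) ln h - m ln g] vanishes at 0, and its derivative is the quantity
    of [riccati_excess_pos], for [r = h / g], divided by [x r]. *)
Lemma contiguous_log_ineq (k m X : R) (g h h' : R -> R) :
  k <= 0 -> 0 < m -> 0 < X -> g 0 = 1 ->
  (forall x, is_derive g x (k * g x - (1 + k ^ 2) / m * x * h x)) ->
  (forall x, is_derive h x (h' x)) ->
  (forall x, x * h' x = m * (g x - h x) - k * x * h x) ->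
  (forall x, 0 <= x <= X -> 0 < g x) ->
  0 < h X /\ m * ln (g X) < (m + 2) * ln (h X).
Proof.
  intros Hk Hm HX Hg0 Hg Hh Heq Hpos.
  assert (Hh0 : h 0 = 1).
  { assert (H := Heq 0). rewrite Hg0 in H.
    apply Rmult_eq_reg_l with m; lra. }
  assert (Hhpos : forall x, 0 <= x <= X -> 0 < h x).
  { intros x Hx. destruct (Rle_lt_or_eq_dec 0 x (proj1 Hx)) as [Hx0|Hx0]; [|subst x; lra].
    (* x (exp (k x) h)' = m exp (k x) (g - h) is positive wherever h <= 0. *)
    assert (Hd : forall y, is_derive (fun y => exp (k * y) * h y) y
                             (exp (k * y) * (h' y + k * h y))).
    { intros y. auto_derive.
      - repeat split; auto; eexists; apply Hh.
      - replace (Derive _ y) with (h' y) by (symmetry; apply is_derive_unique, Hh). ring. }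
    apply Rmult_lt_reg_l with (exp (k * x)); [apply exp_pos|]. rewrite Rmult_0_r.
    apply (pos_of_derive_pos_where_nonpos (fun y => exp (k * y) * h y)); [exact Hx0| | |].
    - rewrite Rmult_0_r, exp_0. lra.
    - intros c _. apply derivable_continuous_pt. eexists. apply is_derive_Reals, Hd.
    - intros p Hp Hhp. eexists. split; [|apply Hd].
      apply Rmult_lt_0_compat; [apply exp_pos|].
      assert (Hgp : 0 < g p) by (apply Hpos; lra).
      assert (Hhp0 : h p <= 0).
      { destruct (Rle_or_lt (h p) 0) as [|Hc]; [assumption|].
        exfalso. assert (0 < exp (k * p) * h p); [|lra].
        apply Rmult_lt_0_compat; [apply exp_pos|exact Hc]. }
      apply Rmult_lt_reg_l with p; [lra|].
      rewrite Rmult_plus_distr_l, Heq.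
      assert (0 < m * (g p - h p)) by (apply Rmult_lt_0_compat; lra). lra. }
  split; [apply Hhpos; lra|].
  set (r := fun x => h x / g x).
  set (r' := fun x => (h' x * g x - h x * (k * g x - (1 + k ^ 2) / m * x * h x)) / g x ^ 2).
  assert (HE : forall x, 0 < x <= X ->
    0 < m * (m + 2) * (1 - r x) - 2 * k * (m + 1) * x * r x + (1 + k ^ 2) * x ^ 2 * r x ^ 2).
  { intros x Hx. apply (riccati_excess_pos k m x r r'); try lra.
    - unfold r. rewrite Hg0, Hh0. field.
    - intros y Hy. assert (Hgy : 0 < g y) by (apply Hpos; lra).
      unfold r, r'. apply is_derive_div; [apply Hh|apply Hg|lra].
    - intros y Hy. unfold r. apply Rdiv_lt_0_compat; [apply Hhpos|apply Hpos]; lra.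
    - intros y Hy. assert (Hgy : 0 < g y) by (apply Hpos; lra). unfold r, r'.
      replace (y * ((h' y * g y - h y * (k * g y - (1 + k ^ 2) / m * y * h y)) / g y ^ 2))
        with (((y * h' y) * g y - y * h y * (k * g y - (1 + k ^ 2) / m * y * h y)) / g y ^ 2)
        by (field; lra).
      rewrite Heq. field. lra. }
  set (D := fun x => (m + 2) * ln (h x) - m * ln (g x)).
  assert (HD : forall x, 0 <= x <= X -> is_derive D x
      ((m + 2) * (h' x / h x) - m * ((k * g x - (1 + k ^ 2) / m * x * h x) / g x))).
  { intros x Hx. unfold D. assert (Hgx := Hpos x Hx). assert (Hhx := Hhpos x Hx).
    auto_derive.
    - repeat split; auto; eexists; [apply Hh|apply Hg].
    - rewrite (is_derive_unique _ _ _ (Hh x) : Derive (fun y => h y) x = _).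
      rewrite (is_derive_unique _ _ _ (Hg x) : Derive (fun y => g y) x = _). field. lra. }
  enough (0 < D X) by (unfold D in *; lra).
  apply pos_of_derive_pos_where_nonpos; [exact HX| | |].
  - unfold D. rewrite Hg0, Hh0, ln_1. lra.
  - intros c Hc. apply derivable_continuous_pt. eexists. apply is_derive_Reals, HD, Hc.
  - intros p Hp _. eexists. split; [|apply HD; lra].
    assert (Hgp : 0 < g p) by (apply Hpos; lra).
    assert (Hhp : 0 < h p) by (apply Hhpos; lra).
    assert (HEp := HE p Hp).
    apply Rmult_lt_reg_l with (p * r p).
    { apply Rmult_lt_0_compat; [lra|]. apply Rdiv_lt_0_compat; assumption. }
    rewrite Rmult_0_r. unfold r in *.
    replace (p * (h p / g p) *
      ((m + 2) * (h' p / h p) - m * ((k * g p - (1 + k ^ 2) / m * p * h p) / g p)))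
     with ((m + 2) * (p * h' p) / g p - p * h p / g p * m * ((k * g p - (1 + k ^ 2) / m * p * h p) / g p))
     by (field; lra).
    rewrite Heq.
    match goal with |- 0 < ?a => match type of HEp with 0 < ?b => replace a with b end end; [exact HEp|].
    field. lra.
Qed.

(** * Nonvanishing of the Gamma function *)

Lemma im_le_Cmod (z : C) : Rabs (Im z) <= Cmod z.
Proof. eapply Rle_trans; [apply Rmax_r|apply Rmax_Cmod]. Qed.

(** Componentwise convergence of a complex sequence. *)
Definition is_Clim_seq (u : nat -> C) (l : C) : Prop :=
  is_lim_seq (fun n => Re (u n)) (Re l) /\ is_lim_seq (fun n => Im (u n)) (Im l).

Lemma CLim_seq_unique (u : nat -> C) (l : C) : is_Clim_seq u l -> CLim_seq u = l.
Proof.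
  intros [H1 H2]. unfold CLim_seq.
  rewrite (is_lim_seq_unique _ _ H1), (is_lim_seq_unique _ _ H2). now destruct l.
Qed.

Lemma is_Clim_seq_mult (u v : nat -> C) (a b : C) :
  is_Clim_seq u a -> is_Clim_seq v b -> is_Clim_seq (fun n => u n * v n)%C (a * b)%C.
Proof.
  intros [Hu1 Hu2] [Hv1 Hv2]; split; simpl.
  - apply is_lim_seq_minus'; apply is_lim_seq_mult'; assumption.
  - apply is_lim_seq_plus'; apply is_lim_seq_mult'; assumption.
Qed.

Lemma is_lim_seq_inv_S (B : R) : is_lim_seq (fun n => B / INR (S n)) 0.
Proof.
  replace 0 with (B * 0) by ring.
  apply is_lim_seq_mult'; [apply is_lim_seq_const|].
  apply (is_lim_seq_incr_1 (fun n => / INR n)).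
  exact (is_lim_seq_inv _ p_infty is_lim_seq_INR ltac:(discriminate)).
Qed.

(** [x n + B / (n + 1)] decreases and is bounded below. *)
Lemma ex_finite_lim_telescoping_steps (x : nat -> R) (B : R) :
  (forall n, Rabs (x (S n) - x n) <= B / INR (S n) - B / INR (S (S n))) ->
  ex_finite_lim_seq x.
Proof.
  intros Hx.
  assert (Hy : ex_finite_lim_seq (fun n => x n + B / INR (S n))).
  { apply ex_finite_lim_seq_decr with (x 0%nat - B).
    - intros n. specialize (Hx n). apply Rabs_le_between in Hx. lra.
    - intros n.
      assert (HB : x 0%nat - B + B / INR (S n) <= x n).
      { induction n as [|n IH]; [simpl; lra|].
        specialize (Hx n). apply Rabs_le_between in Hx. lra. }
      assert (H0 : 0 <= B / INR (S n)).
      { assert (Hp : 0 < INR (S n)) by (apply lt_0_INR; lia).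
        assert (Hp2 : INR (S (S n)) = INR (S n) + 1) by apply S_INR.
        assert (Hn := Rle_trans _ _ _ (Rabs_pos _) (Hx n)).
        replace (B / INR (S n)) with
          ((B / INR (S n) - B / INR (S (S n))) * (INR (S n) + 1))
          by (rewrite Hp2; field; lra).
        apply Rmult_le_pos; lra. }
      lra. }
  destruct Hy as [l Hl]. exists l.
  apply is_lim_seq_ext with (fun n => (x n + B / INR (S n)) - B / INR (S n)).
  - intros n. ring.
  - replace l with (l - 0) by ring.
    apply is_lim_seq_minus'; [exact Hl|apply is_lim_seq_inv_S].
Qed.

(** Convergence of an infinite product whose factors are
    [1 + O(1 / (n (n + 1)))], the bound being telescoping. *)
Lemma Clim_of_relative_steps (w : nat -> C) (K : R) :
  (forall n, (1 <= n)%nat ->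
     Cmod (w (S n) - w n) <= K / (INR n * INR (S n)) * Cmod (w n)) ->
  exists l, is_Clim_seq w l.
Proof.
  intros Hw.
  assert (Hdec : forall n, (1 <= n)%nat ->
     K / (INR n * INR (S n)) = K / INR n - K / INR (S n)).
  { intros n Hn. assert (0 < INR n) by (apply lt_0_INR; lia).
    rewrite S_INR. field. lra. }
  assert (Hbound : forall n,
     exp (K / INR (S n)) * Cmod (w (S n)) <= exp K * Cmod (w 1%nat)).
  { induction n as [|n IH].
    - simpl. rewrite Rdiv_1_r. lra.
    - eapply Rle_trans; [|exact IH].
      assert (Hs := Hw (S n) ltac:(lia)). rewrite Hdec in Hs by lia.
      set (t := K / INR (S n) - K / INR (S (S n))) in *.
      assert (Ht : 1 + t <= exp t) by apply exp_ineq1_le.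
      replace (K / INR (S n)) with (K / INR (S (S n)) + t) by (unfold t; ring).
      rewrite exp_plus, Rmult_assoc. apply Rmult_le_compat_l; [apply Rlt_le, exp_pos|].
      replace (w (S (S n))) with ((w (S (S n)) - w (S n)) + w (S n))%C by ring.
      eapply Rle_trans; [apply Cmod_triangle|].
      assert (0 <= Cmod (w (S n))) by apply Cmod_ge_0. nra. }
  (* A negative K forces w 1 = 0, and then every later term vanishes. *)
  assert (HK : 0 <= K \/ Cmod (w 1%nat) <= 0).
  { destruct (Rle_or_lt 0 K) as [|HK]; [now left|right].
    assert (H := Hw 1%nat (le_n _)). simpl in H.
    assert (0 <= Cmod (w 2%nat - w 1%nat)) by apply Cmod_ge_0.
    assert (0 <= Cmod (w 1%nat)) by apply Cmod_ge_0.
    replace (K / (1 * (1 + 1))) with (K / 2) in H by field. nra. }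
  assert (Hstep : forall n, Cmod (w (S (S n)) - w (S n))
     <= (K * (exp K * Cmod (w 1%nat))) / INR (S n)
        - (K * (exp K * Cmod (w 1%nat))) / INR (S (S n))).
  { intros n. assert (Hs := Hw (S n) ltac:(lia)).
    assert (Hp : 0 < INR (S n)) by (apply lt_0_INR; lia).
    assert (Hp2 : INR (S (S n)) = INR (S n) + 1) by apply S_INR.
    assert (H1 : 0 <= Cmod (w 1%nat)) by apply Cmod_ge_0.
    assert (Hb := Hbound n).
    replace (K * (exp K * Cmod (w 1%nat)) / INR (S n)
      - K * (exp K * Cmod (w 1%nat)) / INR (S (S n)))
      with (K / (INR (S n) * INR (S (S n))) * (exp K * Cmod (w 1%nat)))
      by (rewrite Hp2; field; lra).
    eapply Rle_trans; [exact Hs|].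
    assert (Hm : 0 <= Cmod (w (S n))) by apply Cmod_ge_0.
    destruct HK as [HK|HK].
    - assert (0 <= K / INR (S n)) by (apply Rmult_le_pos; [lra|apply Rlt_le, Rinv_0_lt_compat, Hp]).
      apply Rmult_le_compat_l.
      + apply Rmult_le_pos; [lra|]. apply Rlt_le, Rinv_0_lt_compat, Rmult_lt_0_compat; lra.
      + eapply Rle_trans; [|exact Hb].
        assert (1 + K / INR (S n) <= exp (K / INR (S n))) by apply exp_ineq1_le. nra.
    - assert (Hz : Cmod (w 1%nat) = 0) by lra. rewrite Hz in *.
      assert (0 < exp (K / INR (S n))) by apply exp_pos.
      assert (Cmod (w (S n)) = 0) by nra. rewrite H0. lra. }
  destruct (ex_finite_lim_telescoping_steps (fun n => Re (w (S n)))
              (K * (exp K * Cmod (w 1%nat)))) as [a Ha].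
  { intros n. eapply Rle_trans; [|apply Hstep].
    eapply Rle_trans; [|apply re_le_Cmod]. right. reflexivity. }
  destruct (ex_finite_lim_telescoping_steps (fun n => Im (w (S n)))
              (K * (exp K * Cmod (w 1%nat)))) as [b Hb].
  { intros n. eapply Rle_trans; [|apply Hstep].
    eapply Rle_trans; [|apply im_le_Cmod].
    right. reflexivity. }
  exists (a, b). split; apply is_lim_seq_incr_1; assumption.
Qed.

Lemma Cexp_plus (z w : C) : Cexp (z + w) = (Cexp z * Cexp w)%C.
Proof.
  destruct z as [x y], w as [u v]. unfold Cexp, Cmult; simpl.
  rewrite exp_plus, cos_plus, sin_plus. f_equal; ring.
Qed.

Lemma Cmod_Cexp (z : C) : Cmod (Cexp z) = exp (Re z).
Proof.
  unfold Cmod, Cexp; simpl.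
  replace (_ + _) with (exp (Re z) * exp (Re z) * ((sin (Im z))² + (cos (Im z))²))
    by (unfold Rsqr; ring).
  rewrite sin2_cos2, Rmult_1_r. apply sqrt_square, Rlt_le, exp_pos.
Qed.

Lemma Cexp_neq_0 (z : C) : Cexp z <> RtoC 0.
Proof. apply Cmod_gt_0. rewrite Cmod_Cexp. apply exp_pos. Qed.

Lemma exp_nondecreasing (x y : R) : x <= y -> exp x <= exp y.
Proof. intros [H|H]; [apply Rlt_le, exp_increasing, H|right; now rewrite H]. Qed.

(** First-order Taylor bound along the ray of [z]; the mean value inequality is
    applied twice to the components [A], [B] of [exp (t z)]. *)
Lemma Cexp_linearization_bound (z : C) :
  exists K, 0 <= K /\ forall t, 0 <= t <= 1 ->
    Cmod (Cexp (z * RtoC t) - RtoC 1 - z * RtoC t) <= K * t ^ 2.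
Proof.
  destruct z as [x y].
  set (S := Rabs x + Rabs y). set (D := S * exp (Rabs x)).
  assert (HS : 0 <= S) by (unfold S; assert (0 <= Rabs x) by apply Rabs_pos;
    assert (0 <= Rabs y) by apply Rabs_pos; lra).
  assert (HD : 0 <= D) by (apply Rmult_le_pos; [exact HS|apply Rlt_le, exp_pos]).
  set (A := fun t => exp (x * t) * cos (y * t)).
  set (B := fun t => exp (x * t) * sin (y * t)).
  assert (HA : forall t, is_derive A t (x * A t - y * B t)).
  { intros t. unfold A, B. auto_derive; [exact I|ring]. }
  assert (HB : forall t, is_derive B t (x * B t + y * A t)).
  { intros t. unfold A, B. auto_derive; [exact I|ring]. }
  assert (Hcomb : forall a b c, Rabs a <= c -> Rabs b <= c ->
            Rabs (x * a + y * b) <= S * c).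
  { intros a b c Ha Hb. eapply Rle_trans; [apply Rabs_triang|].
    rewrite !Rabs_mult. unfold S.
    assert (0 <= Rabs x) by apply Rabs_pos. assert (0 <= Rabs y) by apply Rabs_pos. nra. }
  assert (Hexp : forall t, Rabs t <= 1 -> exp (x * t) <= exp (Rabs x)).
  { intros t Ht. apply exp_nondecreasing. eapply Rle_trans; [apply Rle_abs|].
    rewrite Rabs_mult. assert (0 <= Rabs x) by apply Rabs_pos. nra. }
  assert (HAe : forall t, Rabs t <= 1 -> Rabs (A t) <= exp (Rabs x)).
  { intros t Ht. unfold A. rewrite Rabs_mult, (Rabs_right (exp _)) by (apply Rgt_ge, exp_pos).
    assert (Rabs (cos (y * t)) <= 1) by (apply Rabs_le, COS_bound).
    assert (H1 := Hexp t Ht). assert (0 < exp (x * t)) by apply exp_pos. nra. }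
  assert (HBe : forall t, Rabs t <= 1 -> Rabs (B t) <= exp (Rabs x)).
  { intros t Ht. unfold B. rewrite Rabs_mult, (Rabs_right (exp _)) by (apply Rgt_ge, exp_pos).
    assert (Rabs (sin (y * t)) <= 1) by (apply Rabs_le, SIN_bound).
    assert (H1 := Hexp t Ht). assert (0 < exp (x * t)) by apply exp_pos. nra. }
  assert (HA0 : A 0 = 1) by (unfold A; rewrite !Rmult_0_r, exp_0, cos_0; ring).
  assert (HB0 : B 0 = 0) by (unfold B; rewrite !Rmult_0_r, sin_0; ring).
  assert (HA1 : forall t, Rabs t <= 1 -> Rabs (A t - 1) <= D * Rabs t).
  { intros t Ht. rewrite <- HA0. replace (Rabs t) with (Rabs (t - 0)) by (f_equal; ring).
    apply bounded_variation with (fun t => x * A t - y * B t).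
    intros s Hs. rewrite !Rminus_0_r in Hs. split; [apply HA|].
    replace (x * A s - y * B s) with (x * A s + y * - B s) by ring.
    apply Hcomb; [apply HAe|rewrite Rabs_Ropp; apply HBe]; lra. }
  assert (HB1 : forall t, Rabs t <= 1 -> Rabs (B t) <= D * Rabs t).
  { intros t Ht. replace (B t) with (B t - B 0) by (rewrite HB0; ring).
    replace (Rabs t) with (Rabs (t - 0)) by (f_equal; ring).
    apply bounded_variation with (fun t => x * B t + y * A t).
    intros s Hs. rewrite !Rminus_0_r in Hs. split; [apply HB|].
    apply Hcomb; [apply HBe|apply HAe]; lra. }
  exists (2 * (S * D)). split; [assert (0 <= S * D) by (apply Rmult_le_pos; assumption); lra|].
  intros t Ht.
  assert (Hta : Rabs t = t) by (apply Rabs_right; lra).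
  assert (HA2 : Rabs (A t - 1 - x * t) <= S * D * t ^ 2).
  { replace (A t - 1 - x * t) with ((fun t => A t - x * t) t - (fun t => A t - x * t) 0)
      by (simpl; rewrite HA0; ring).
    replace (S * D * t ^ 2) with (S * (D * t) * Rabs (t - 0))
      by (rewrite Rminus_0_r, Hta; ring).
    apply (bounded_variation (fun t => A t - x * t) (fun t => x * (A t - 1) + y * - B t)).
    intros s Hs. rewrite !Rminus_0_r, Hta in Hs. split.
    - replace (x * (A s - 1) + y * - B s) with ((x * A s - y * B s) - x) by ring.
      apply (is_derive_minus (V:=R_NormedModule)); [apply HA|]. auto_derive; [exact I|ring].
    - assert (D * Rabs s <= D * t) by (apply Rmult_le_compat_l; lra).
      apply Hcomb; [eapply Rle_trans; [apply HA1; lra|lra]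
                   |rewrite Rabs_Ropp; eapply Rle_trans; [apply HB1; lra|lra]]. }
  assert (HB2 : Rabs (B t - y * t) <= S * D * t ^ 2).
  { replace (B t - y * t) with ((fun t => B t - y * t) t - (fun t => B t - y * t) 0)
      by (simpl; rewrite HB0; ring).
    replace (S * D * t ^ 2) with (S * (D * t) * Rabs (t - 0))
      by (rewrite Rminus_0_r, Hta; ring).
    apply (bounded_variation (fun t => B t - y * t) (fun t => x * B t + y * (A t - 1))).
    intros s Hs. rewrite !Rminus_0_r, Hta in Hs. split.
    - replace (x * B s + y * (A s - 1)) with ((x * B s + y * A s) - y) by ring.
      apply (is_derive_minus (V:=R_NormedModule)); [apply HB|]. auto_derive; [exact I|ring].
    - assert (D * Rabs s <= D * t) by (apply Rmult_le_compat_l; lra).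
      apply Hcomb; [eapply Rle_trans; [apply HB1; lra|lra]
                   |eapply Rle_trans; [apply HA1; lra|lra]]. }
  replace (Cexp ((x, y) * RtoC t) - RtoC 1 - (x, y) * RtoC t)%C
    with (RtoC (A t - 1 - x * t) + Ci * RtoC (B t - y * t))%C.
  2:{ unfold A, B, Cexp, Cminus, Cmult, Cplus, Copp, Ci, RtoC; simpl.
      rewrite !Rmult_0_r, !Rminus_0_r, !Rplus_0_l. f_equal; ring. }
  eapply Rle_trans; [apply Cmod_triangle|].
  rewrite Cmod_mult, Cmod_Ci, !Cmod_R. lra.
Qed.

(** The Euler-Gauss sequence, whose limit is [CGamma z]. *)
Definition gauss_gamma (z : C) (n : nat) : C :=
  (RtoC (INR (fact n)) * Cexp (z * RtoC (ln (INR n))) / Cpoch z (S n))%C.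

Lemma Cplus_INR_neq_0 (z : C) (n : nat) : 0 < Re z -> (z + RtoC (INR n))%C <> RtoC 0.
Proof.
  intros Hz H. apply (f_equal Re) in H. destruct z as [x y]; simpl in *.
  assert (0 <= INR n) by apply pos_INR. lra.
Qed.

Lemma Cpoch_neq_0 (z : C) (n : nat) : 0 < Re z -> Cpoch z n <> RtoC 0.
Proof.
  intros Hz. induction n as [|n IH]; simpl.
  - exact C1_nz.
  - apply Cmult_neq_0; [exact IH|]. apply Cplus_INR_neq_0, Hz.
Qed.

Lemma fact_C_neq_0 (n : nat) : RtoC (INR (fact n)) <> RtoC 0.
Proof. intros H. apply (INR_fact_neq_0 n), RtoC_inj, H. Qed.

Lemma gauss_gamma_neq_0 (z : C) (n : nat) : 0 < Re z -> gauss_gamma z n <> RtoC 0.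
Proof.
  intros Hz. unfold gauss_gamma, Cdiv.
  repeat apply Cmult_neq_0; [apply fact_C_neq_0|apply Cexp_neq_0|].
  intros H. apply C1_nz. rewrite <- (Cinv_r (Cpoch z (S n))), H by now apply Cpoch_neq_0.
  ring.
Qed.

Lemma gauss_gamma_step (z : C) (n : nat) : 0 < Re z -> (1 <= n)%nat ->
  (gauss_gamma z (S n) * (RtoC 1 + z / RtoC (INR (S n)))
   = gauss_gamma z n * Cexp (z * RtoC (ln (INR (S n)) - ln (INR n))))%C.
Proof.
  intros Hz Hn. unfold gauss_gamma.
  replace (z * RtoC (ln (INR (S n))))%C
    with (z * RtoC (ln (INR n)) + z * RtoC (ln (INR (S n)) - ln (INR n)))%C
    by (rewrite RtoC_minus; ring).
  rewrite Cexp_plus.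
  change (Cpoch z (S (S n))) with (Cpoch z (S n) * (z + RtoC (INR (S n))))%C.
  change (fact (S n)) with (S n * fact n)%nat. rewrite mult_INR, RtoC_mult.
  assert (HS : RtoC (INR (S n)) <> RtoC 0).
  { intros H. apply RtoC_inj in H. apply (not_0_INR (S n)) in H; [exact H|lia]. }
  field. split; [now apply Cpoch_neq_0|]. split; [exact HS|now apply Cplus_INR_neq_0].
Qed.

Lemma ln_step_bounds (n : nat) : (1 <= n)%nat ->
  / INR (S n) <= ln (INR (S n)) - ln (INR n) <= / INR n.
Proof.
  intros Hn. assert (Hp : 0 < INR n) by (apply lt_0_INR; lia).
  assert (Hp2 : INR (S n) = INR n + 1) by apply S_INR.
  assert (Hln : forall x, 0 < x -> ln x <= x - 1).
  { intros x Hx. assert (H := exp_ineq1_le (ln x)). rewrite exp_ln in H by exact Hx. lra. }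
  assert (Hi : 0 < INR (S n)) by lra.
  split.
  - assert (H := Hln (INR n / INR (S n)) ltac:(apply Rdiv_lt_0_compat; lra)).
    rewrite ln_div in H by lra.
    replace (INR n / INR (S n) - 1) with (- / INR (S n)) in H by (rewrite Hp2; field; lra).
    lra.
  - assert (H := Hln (INR (S n) / INR n) ltac:(apply Rdiv_lt_0_compat; lra)).
    rewrite ln_div in H by lra.
    replace (INR (S n) / INR n - 1) with (/ INR n) in H by (rewrite Hp2; field; lra).
    lra.
Qed.

(** With [t = ln (1 + 1/n)], the two factors of [gauss_gamma_step] differ by
    [O(1 / (n (n + 1)))]. *)
Lemma gauss_factor_diff_bound (z : C) :
  exists K, 0 <= K /\ forall n, (1 <= n)%nat ->
    Cmod (Cexp (z * RtoC (ln (INR (S n)) - ln (INR n))) - (RtoC 1 + z / RtoC (INR (S n))))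
    <= K / (INR n * INR (S n)).
Proof.
  destruct (Cexp_linearization_bound z) as [K [HK Hz]].
  exists (2 * K + Cmod z).
  assert (Hcz : 0 <= Cmod z) by apply Cmod_ge_0.
  split; [lra|]. intros n Hn.
  assert (Hp : 1 <= INR n) by (apply (le_INR 1); exact Hn).
  assert (Hp2 : INR (S n) = INR n + 1) by apply S_INR.
  destruct (ln_step_bounds n Hn) as [H1 H2].
  set (t := ln (INR (S n)) - ln (INR n)) in *.
  assert (Hi : 0 < / INR (S n)) by (apply Rinv_0_lt_compat; lra).
  assert (Hi1 : / INR n <= 1) by (rewrite <- Rinv_1; apply Rinv_le_contravar; lra).
  replace (Cexp (z * RtoC t) - (RtoC 1 + z / RtoC (INR (S n))))%C
    with ((Cexp (z * RtoC t) - RtoC 1 - z * RtoC t) + z * RtoC (t - / INR (S n)))%C.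
  2:{ rewrite RtoC_minus, RtoC_inv by lra. unfold Cdiv. ring. }
  eapply Rle_trans; [apply Cmod_triangle|].
  rewrite Cmod_mult, Cmod_R, (Rabs_right (t - _)) by lra.
  assert (Ha := Hz t ltac:(lra)).
  assert (Hn1 : / INR n - / INR (S n) = / (INR n * INR (S n))) by (rewrite Hp2; field; lra).
  assert (Hb : t ^ 2 <= 2 * / (INR n * INR (S n))).
  { apply Rle_trans with (/ INR n * / INR n).
    - replace (t ^ 2) with (t * t) by ring. apply Rmult_le_compat; lra.
    - replace (2 * / (INR n * INR (S n))) with (/ INR n * (2 * / INR (S n))) by (field; lra).
      apply Rmult_le_compat_l; [apply Rlt_le, Rinv_0_lt_compat; lra|].
      apply Rmult_le_reg_l with (INR n * INR (S n)); [nra|].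
      replace (INR n * INR (S n) * / INR n) with (INR (S n)) by (field; lra).
      replace (INR n * INR (S n) * (2 * / INR (S n))) with (2 * INR n) by (field; lra). lra. }
  assert (Cmod z * (t - / INR (S n)) <= Cmod z * / (INR n * INR (S n)))
    by (apply Rmult_le_compat_l; lra).
  assert (K * t ^ 2 <= K * (2 * / (INR n * INR (S n)))) by (apply Rmult_le_compat_l; lra).
  unfold Rdiv. lra.
Qed.

Lemma gauss_gamma_cv (z : C) : 0 < Re z -> exists l, is_Clim_seq (gauss_gamma z) l.
Proof.
  intros Hz. destruct (gauss_factor_diff_bound z) as [K [HK Hb]].
  apply Clim_of_relative_steps with K. intros n Hn.
  assert (Hs := gauss_gamma_step z n Hz Hn). assert (Hd := Hb n Hn).
  set (e := Cexp (z * RtoC (ln (INR (S n)) - ln (INR n)))) in *.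
  set (d := (RtoC 1 + z / RtoC (INR (S n)))%C) in *.
  assert (Hdm : 1 <= Cmod d).
  { apply Rle_trans with (Re d).
    - unfold d, Cdiv. rewrite <- RtoC_inv by (apply not_0_INR; lia).
      assert (0 < / INR (S n)) by (apply Rinv_0_lt_compat, lt_0_INR; lia).
      change (1 <= 1 + Re (z * RtoC (/ INR (S n)))). rewrite re_scal_r. nra.
    - eapply Rle_trans; [apply Rle_abs|apply re_le_Cmod]. }
  assert (Hgd : ((gauss_gamma z (S n) - gauss_gamma z n) * d = gauss_gamma z n * (e - d))%C).
  { replace ((gauss_gamma z (S n) - gauss_gamma z n) * d)%C
      with (gauss_gamma z (S n) * d - gauss_gamma z n * d)%C by ring. rewrite Hs. ring. }
  apply (f_equal Cmod) in Hgd. rewrite !Cmod_mult in Hgd.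
  assert (0 <= Cmod (gauss_gamma z (S n) - gauss_gamma z n)) by apply Cmod_ge_0.
  assert (0 <= Cmod (gauss_gamma z n)) by apply Cmod_ge_0. nra.
Qed.

(** Convergence of the reciprocals is what excludes a zero limit. *)
Lemma gauss_gamma_inv_cv (z : C) : 0 < Re z ->
  exists l, is_Clim_seq (fun n => / gauss_gamma z n)%C l.
Proof.
  intros Hz. destruct (gauss_factor_diff_bound z) as [K [HK Hb]].
  assert (Hrz : 0 <= Re z) by lra.
  apply Clim_of_relative_steps with K. intros n Hn.
  assert (Hs := gauss_gamma_step z n Hz Hn). assert (Hd := Hb n Hn).
  assert (He : 1 <= Cmod (Cexp (z * RtoC (ln (INR (S n)) - ln (INR n))))).
  { rewrite Cmod_Cexp, re_scal_r, <- exp_0. apply exp_nondecreasing.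
    destruct (ln_step_bounds n Hn) as [H1 _].
    assert (0 < / INR (S n)) by (apply Rinv_0_lt_compat, lt_0_INR; lia).
    apply Rmult_le_pos; lra. }
  set (e := Cexp (z * RtoC (ln (INR (S n)) - ln (INR n)))) in *.
  set (d := (RtoC 1 + z / RtoC (INR (S n)))%C) in *.
  assert (Hg := gauss_gamma_neq_0 z n Hz). assert (Hg' := gauss_gamma_neq_0 z (S n) Hz).
  set (g := gauss_gamma z n) in *. set (g' := gauss_gamma z (S n)) in *.
  assert (Hgd : ((/ g' - / g) * e = / g * (d - e))%C).
  { assert (Hd' : d = (g * e / g')%C) by (rewrite <- Hs; field; exact Hg').
    rewrite Hd'. field. now split. }
  apply (f_equal Cmod) in Hgd. rewrite !Cmod_mult in Hgd.
  replace (d - e)%C with (- (e - d))%C in Hgd by ring. rewrite Cmod_opp in Hgd.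
  assert (0 <= Cmod (/ g' - / g)) by apply Cmod_ge_0.
  assert (0 <= Cmod (/ g)) by apply Cmod_ge_0. nra.
Qed.

Lemma CGamma_neq_0 (z : C) : 0 < Re z -> CGamma z <> RtoC 0.
Proof.
  intros Hz.
  destruct (gauss_gamma_cv z Hz) as [a Ha]. destruct (gauss_gamma_inv_cv z Hz) as [b Hb].
  unfold CGamma. change (CLim_seq (gauss_gamma z) <> RtoC 0).
  rewrite (CLim_seq_unique _ _ Ha). intros H0.
  assert (H := is_Clim_seq_mult _ _ _ _ Ha Hb). rewrite H0 in H. destruct H as [H _].
  apply is_lim_seq_ext with (v := fun _ => 1) in H.
  - apply is_lim_seq_unique in H. rewrite Lim_seq_const in H. injection H. simpl. lra.
  - intros n. rewrite Cinv_r by now apply gauss_gamma_neq_0. reflexivity.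
Qed.

Lemma Cpoch_real (x : R) (n : nat) : exists y, Cpoch (RtoC x) n = RtoC y.
Proof.
  induction n as [|n [y Hy]]; simpl; [now exists 1|].
  exists (y * (x + INR n)). rewrite Hy, <- RtoC_plus, <- RtoC_mult. reflexivity.
Qed.

Lemma CGamma_real (x : R) : 0 < x -> Im (CGamma (RtoC x)) = 0.
Proof.
  intros Hx. unfold CGamma, CLim_seq; simpl Im.
  rewrite (Lim_seq_ext _ (fun _ => 0)); [now rewrite Lim_seq_const|].
  intros n. destruct (Cpoch_real x (S n)) as [y Hy].
  assert (Hy0 : y <> 0).
  { intros H. apply (Cpoch_neq_0 (RtoC x) (S n) Hx). now rewrite Hy, H. }
  change (Im (gauss_gamma (RtoC x) n) = 0). unfold gauss_gamma, Cdiv. rewrite Hy.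
  rewrite <- RtoC_inv by exact Hy0. rewrite im_scal_r, im_scal_l, <- RtoC_mult.
  unfold Cexp; simpl. rewrite sin_0. ring.
Qed.

Lemma coulombC_neq_0 (L eta : R) : -1 < L -> coulombC L eta <> 0.
Proof.
  intros HL. unfold coulombC, Rdiv.
  assert (Hre : Re (CGamma (RtoC (2 * L + 2))) <> 0).
  { intros H. apply (CGamma_neq_0 (RtoC (2 * L + 2))); [simpl; lra|].
    assert (Hi := CGamma_real (2 * L + 2) ltac:(lra)).
    destruct (CGamma (RtoC (2 * L + 2))) as [a b]; simpl in *. now subst. }
  repeat apply Rmult_integral_contrapositive_currified.
  - apply Rgt_not_eq, exp_pos.
  - apply Rgt_not_eq, exp_pos.
  - apply Rgt_not_eq, Cmod_gt_0, CGamma_neq_0. simpl. lra.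
  - now apply Rinv_neq_0_compat.
Qed.

(** * Coefficients of the Kummer series *)

(** Coefficient of [rho ^ n] in 1F1(L+1 - i eta, 2L+2; 2 i rho). *)
Definition kummer_coef (L eta : R) (n : nat) : C :=
  (Cpoch (RtoC (L + 1) - Ci * RtoC eta) n / Cpoch (RtoC (2 * L + 2)) n
   * (RtoC 2 * Ci) ^ n / RtoC (INR (fact n)))%C.

Lemma Cpoch_shift (z : C) (n : nat) : (Cpoch z (S n) = z * Cpoch (z + RtoC 1) n)%C.
Proof.
  induction n as [|n IH]; [simpl; ring|].
  change (Cpoch z (S (S n))) with (Cpoch z (S n) * (z + RtoC (INR (S n))))%C.
  rewrite IH, S_INR, (RtoC_plus (INR n)). simpl. ring.
Qed.

Lemma INR_S_C_neq_0 (n : nat) : (RtoC (INR n) + RtoC 1)%C <> RtoC 0.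
Proof.
  rewrite <- RtoC_plus, <- S_INR. intros H. apply RtoC_inj in H.
  apply (not_0_INR (S n)) in H; [exact H|lia].
Qed.

Lemma kummer_coef_0 (L eta : R) : kummer_coef L eta 0 = RtoC 1.
Proof. unfold kummer_coef; simpl. field. Qed.

Lemma kummer_coef_S (L eta : R) (n : nat) : -1 < L ->
  (kummer_coef L eta (S n)
     * ((RtoC (2 * L + 2) + RtoC (INR n)) * (RtoC (INR n) + RtoC 1))
   = kummer_coef L eta n
     * (RtoC 2 * Ci * (RtoC (L + 1) - Ci * RtoC eta + RtoC (INR n))))%C.
Proof.
  intros HL. unfold kummer_coef.
  assert (Hb : 0 < Re (RtoC (2 * L + 2))) by (simpl; lra).
  assert (H1 := Cpoch_neq_0 _ n Hb). assert (H2 := Cplus_INR_neq_0 _ n Hb).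
  assert (H3 := INR_S_C_neq_0 n). assert (H4 := fact_C_neq_0 n).
  change (fact (S n)) with (S n * fact n)%nat.
  rewrite mult_INR, RtoC_mult, S_INR, (RtoC_plus (INR n)). simpl Cpoch. simpl Cpow.
  set (b := RtoC (2 * L + 2)) in *. set (a := (RtoC (L + 1) - Ci * RtoC eta)%C) in *.
  field. repeat split; assumption.
Qed.

(** From [(a)_{n+1} = a (a+1)_n] and [(b)_{n+2} = b (b+1) (b+2)_n], with
    [a = L+1 - i eta] and [b = 2L+2]. *)
Lemma kummer_coef_contiguous (L eta : R) (n : nat) : -1 < L ->
  (kummer_coef L eta (S n) * (RtoC (INR n) + RtoC 1)
     * (RtoC (2 * L + 2) * RtoC (2 * L + 3))
   = kummer_coef (L + 1) eta n
     * (RtoC 2 * Ci * (RtoC (L + 1) - Ci * RtoC eta)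
        * (RtoC (2 * L + 2) + RtoC (INR n) + RtoC 1)))%C.
Proof.
  intros HL. unfold kummer_coef.
  replace (RtoC (2 * (L + 1) + 2)) with (RtoC (2 * L + 3) + RtoC 1)%C
    by (rewrite <- RtoC_plus; f_equal; ring).
  replace (RtoC (2 * L + 3)) with (RtoC (2 * L + 2) + RtoC 1)%C
    by (rewrite <- RtoC_plus; f_equal; ring).
  replace (RtoC (L + 1 + 1) - Ci * RtoC eta)%C
    with (RtoC (L + 1) - Ci * RtoC eta + RtoC 1)%C by (rewrite (RtoC_plus (L + 1)); ring).
  assert (Hb : 0 < Re (RtoC (2 * L + 2))) by (simpl; lra).
  set (b := RtoC (2 * L + 2)) in *. set (a := (RtoC (L + 1) - Ci * RtoC eta)%C) in *.
  assert (H1 : (Cpoch b (S n) * (b + RtoC (INR (S n)))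
                = b * ((b + RtoC 1) * Cpoch (b + RtoC 1 + RtoC 1) n))%C).
  { rewrite <- !Cpoch_shift. reflexivity. }
  rewrite S_INR, (RtoC_plus (INR n)) in H1.
  rewrite (Cpoch_shift a).
  assert (Hb1 : 0 < Re (b + RtoC 1)) by (simpl in *; lra).
  assert (Hb2 : 0 < Re (b + RtoC 1 + RtoC 1)) by (simpl in *; lra).
  assert (H2 := Cpoch_neq_0 _ (S n) Hb). assert (H3 := Cpoch_neq_0 _ n Hb2).
  assert (H4 := INR_S_C_neq_0 n). assert (H5 := fact_C_neq_0 n).
  assert (H6 : b <> RtoC 0) by (intros H; rewrite H in Hb; simpl in Hb; lra).
  assert (H7 : (b + RtoC 1)%C <> RtoC 0) by (intros H; rewrite H in Hb1; simpl in Hb1; lra).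
  change (fact (S n)) with (S n * fact n)%nat.
  rewrite mult_INR, RtoC_mult, S_INR, (RtoC_plus (INR n)). simpl Cpow.
  set (P := Cpoch b (S n)) in *. set (Q := Cpoch (b + RtoC 1 + RtoC 1) n) in *.
  set (N := RtoC (INR n)) in *.
  assert (HP : (b * (b + RtoC 1) / P = (b + N + RtoC 1) / Q)%C).
  { transitivity (b * ((b + RtoC 1) * Q) / (P * Q))%C; [field; now split|].
    rewrite <- H1. field. now split. }
  transitivity (b * (b + RtoC 1) / P * (a * Cpoch (a + RtoC 1) n
      * (RtoC 2 * Ci * (RtoC 2 * Ci) ^ n) / RtoC (INR (fact n))))%C.
  { field. repeat split; assumption. }
  rewrite HP. field. repeat split; assumption.
Qed.

Lemma Ci_sqr : (Ci * Ci = - RtoC 1)%C.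
Proof. apply injective_projections; simpl; ring. Qed.

Lemma RtoC_neq_0 (x : R) : x <> 0 -> RtoC x <> RtoC 0.
Proof. intros Hx H. now apply Hx, RtoC_inj. Qed.

Lemma Cmult_reg_r (x y z : C) : z <> RtoC 0 -> (x * z = y * z)%C -> x = y.
Proof.
  intros Hz H. replace x with (x * z / z)%C by (now field). rewrite H. now field.
Qed.

(** With [k = eta / (L+1)], the coefficient form of
    [M_L' - i M_L = k M_L - (1 + k^2) / (2L+3) rho M_{L+1}], where [M_L] is
    1F1(L+1 - i eta, 2L+2; 2 i rho). *)
Lemma kummer_coef_rel_lower (L eta : R) (n : nat) : -1 < L ->
  ((RtoC (INR n) + RtoC 2) * kummer_coef L eta (S (S n))
   = (RtoC (eta / (L + 1)) + Ci) * kummer_coef L eta (S n)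
     - RtoC ((1 + (eta / (L + 1)) ^ 2) / (2 * L + 3)) * kummer_coef (L + 1) eta n)%C.
Proof.
  intros HL.
  assert (H1 := kummer_coef_S L eta (S n) HL).
  assert (H2 := kummer_coef_contiguous L eta n HL).
  set (k := eta / (L + 1)) in *.
  replace (RtoC eta) with (RtoC (L + 1) * RtoC k)%C in *
    by (rewrite <- RtoC_mult; unfold k; f_equal; field; lra).
  rewrite S_INR, (RtoC_plus (INR n)) in H1.
  assert (Hb : RtoC (2 * L + 2) = (RtoC 2 * RtoC (L + 1))%C)
    by (rewrite <- RtoC_mult; f_equal; ring).
  assert (Hm : RtoC (2 * L + 3) <> RtoC 0) by (apply RtoC_neq_0; lra).
  assert (Hl : RtoC (L + 1) <> RtoC 0) by (apply RtoC_neq_0; lra).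
  assert (Hn : (RtoC 2 * RtoC (L + 1) + RtoC (INR n) + RtoC 1)%C <> RtoC 0).
  { rewrite <- RtoC_mult, <- !RtoC_plus. apply RtoC_neq_0.
    assert (0 <= INR n) by apply pos_INR. lra. }
  assert (HN := INR_S_C_neq_0 n).
  assert (Hc : (RtoC ((1 + k ^ 2) / (2 * L + 3)) * RtoC (2 * L + 3)
                = RtoC 1 + RtoC k * RtoC k)%C).
  { rewrite <- !RtoC_mult, <- RtoC_plus. f_equal. field. lra. }
  rewrite Hb in *.
  set (m0 := kummer_coef (L + 1) eta n) in *.
  set (m1 := kummer_coef L eta (S n)) in *.
  set (m2 := kummer_coef L eta (S (S n))) in *.
  generalize dependent (RtoC (INR n)). generalize dependent (RtoC (L + 1)).
  generalize dependent (RtoC (2 * L + 3)).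
  generalize dependent (RtoC ((1 + k ^ 2) / (2 * L + 3))). generalize (RtoC k).
  intros kc c mc Hm Hc l Hb Hl N H1 H2 Hn HN.
  apply Cmult_reg_r with (RtoC 2 * l + N + RtoC 1)%C; [exact Hn|].
  transitivity (m1 * (RtoC 2 * Ci * (l - Ci * (l * kc) + (N + RtoC 1))))%C.
  { rewrite <- H1. ring. }
  assert (H2' : (m1 * (N + RtoC 1) * mc
      = m0 * (Ci * (RtoC 1 - Ci * kc) * (RtoC 2 * l + N + RtoC 1)))%C).
  { apply Cmult_reg_r with (RtoC 2 * l)%C.
    - apply Cmult_neq_0; [apply RtoC_neq_0; lra|exact Hl].
    - transitivity (m1 * (N + RtoC 1) * (RtoC 2 * l * mc))%C; [ring|].
      rewrite H2. ring. }
  apply Cmult_reg_r with mc; [exact Hm|].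
  transitivity ((kc + Ci) * m1 * (RtoC 2 * l + N + RtoC 1) * mc
     + (Ci - kc) * (m1 * (N + RtoC 1) * mc))%C.
  { ring [Ci_sqr]. }
  assert (HQ : ((Ci - kc) * (Ci * (RtoC 1 - Ci * kc)) = - (c * mc))%C).
  { replace ((Ci - kc) * (Ci * (RtoC 1 - Ci * kc)))%C
      with (Ci * Ci * (RtoC 1 + kc * kc) - kc * Ci * (Ci * Ci + RtoC 1))%C by ring.
    rewrite Hc, Ci_sqr. ring. }
  rewrite H2'.
  transitivity ((kc + Ci) * m1 * (RtoC 2 * l + N + RtoC 1) * mc
     + (Ci - kc) * (Ci * (RtoC 1 - Ci * kc)) * m0 * (RtoC 2 * l + N + RtoC 1))%C; [ring|].
  rewrite HQ. ring.
Qed.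

(** The coefficient form of
    [rho (M_{L+1}' - i M_{L+1}) = (2L+3) (M_L - M_{L+1}) - k rho M_{L+1}]. *)
Lemma kummer_coef_rel_raise (L eta : R) (n : nat) : -1 < L ->
  (RtoC (INR (S n)) * kummer_coef (L + 1) eta (S n)
   = RtoC (2 * L + 3) * (kummer_coef L eta (S n) - kummer_coef (L + 1) eta (S n))
     + (Ci - RtoC (eta / (L + 1))) * kummer_coef (L + 1) eta n)%C.
Proof.
  intros HL.
  assert (H1 := kummer_coef_S (L + 1) eta n ltac:(lra)).
  assert (H2 := kummer_coef_contiguous L eta n HL).
  set (k := eta / (L + 1)) in *.
  replace (RtoC eta) with (RtoC (L + 1) * RtoC k)%C in *
    by (rewrite <- RtoC_mult; unfold k; f_equal; field; lra).
  rewrite S_INR, (RtoC_plus (INR n)).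
  assert (Hb : RtoC (2 * L + 2) = (RtoC 2 * RtoC (L + 1))%C)
    by (rewrite <- RtoC_mult; f_equal; ring).
  assert (Hb2 : RtoC (2 * (L + 1) + 2) = (RtoC 2 * RtoC (L + 1) + RtoC 2)%C)
    by (rewrite <- RtoC_mult, <- RtoC_plus; f_equal; ring).
  assert (Hm : RtoC (2 * L + 3) = (RtoC 2 * RtoC (L + 1) + RtoC 1)%C)
    by (rewrite <- RtoC_mult, <- RtoC_plus; f_equal; ring).
  assert (Hl : RtoC (L + 1) <> RtoC 0) by (apply RtoC_neq_0; lra).
  assert (Hn : (RtoC 2 * RtoC (L + 1) + RtoC 2 + RtoC (INR n))%C <> RtoC 0).
  { rewrite <- RtoC_mult, <- !RtoC_plus. apply RtoC_neq_0.
    assert (0 <= INR n) by apply pos_INR. lra. }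
  assert (HN := INR_S_C_neq_0 n).
  rewrite (RtoC_plus (L + 1)) in H1.
  rewrite Hb, Hm in *. rewrite Hb2 in *.
  set (m0 := kummer_coef (L + 1) eta n) in *.
  set (m1 := kummer_coef L eta (S n)) in *.
  set (mt := kummer_coef (L + 1) eta (S n)) in *.
  generalize dependent (RtoC (INR n)). generalize dependent (RtoC (L + 1)).
  generalize (RtoC k).
  intros kc l Hb Hb2 Hm Hl N H1 H2 Hn HN.
  assert (H2' : (m1 * (N + RtoC 1) * (RtoC 2 * l + RtoC 1)
      = m0 * (Ci * (RtoC 1 - Ci * kc) * (RtoC 2 * l + N + RtoC 1)))%C).
  { apply Cmult_reg_r with (RtoC 2 * l)%C.
    - apply Cmult_neq_0; [apply RtoC_neq_0; lra|exact Hl].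
    - transitivity (m1 * (N + RtoC 1) * (RtoC 2 * l * (RtoC 2 * l + RtoC 1)))%C; [ring|].
      rewrite H2. ring. }
  assert (H : (mt * (RtoC 2 * l + RtoC 2 + N)
               = (RtoC 2 * l + RtoC 1) * m1 + (Ci - kc) * m0)%C).
  { apply Cmult_reg_r with (N + RtoC 1)%C; [exact HN|].
    transitivity (mt * ((RtoC 2 * l + RtoC 2 + N) * (N + RtoC 1)))%C; [ring|].
    rewrite H1.
    transitivity (m1 * (N + RtoC 1) * (RtoC 2 * l + RtoC 1) + (Ci - kc) * m0 * (N + RtoC 1))%C;
      [|ring].
    rewrite H2'. ring [Ci_sqr]. }
  transitivity (mt * (RtoC 2 * l + RtoC 2 + N) - (RtoC 2 * l + RtoC 1) * mt)%C; [ring|].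
  rewrite H. ring.
Qed.

(** * Entire real power series *)

(** The ratio of consecutive coefficients is at most a constant over [n + 1]. *)
Lemma kummer_coef_bound (L eta : R) : -1 < L ->
  exists K, 0 <= K /\ forall n, Cmod (kummer_coef L eta n) <= K ^ n / INR (fact n).
Proof.
  intros HL.
  set (a := (RtoC (L + 1) - Ci * RtoC eta)%C).
  assert (Ha : 0 <= Cmod a) by apply Cmod_ge_0.
  set (b := 2 * L + 2). assert (Hb : 0 < b) by (unfold b; lra).
  set (K := Cmod a / b + 1).
  assert (HK : 0 <= Cmod a / b).
  { apply Rmult_le_pos; [exact Ha|apply Rlt_le, Rinv_0_lt_compat, Hb]. }
  exists (2 * K). split; [unfold K; lra|].
  induction n as [|n IH].
  - rewrite kummer_coef_0, Cmod_1. simpl. lra.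
  - assert (H := f_equal Cmod (kummer_coef_S L eta n HL)).
    fold a b in H. rewrite !Cmod_mult, Cmod_Ci, Cmod_R in H.
    rewrite <- !RtoC_plus, !Cmod_R in H.
    assert (HN : 0 <= INR n) by apply pos_INR.
    rewrite (Rabs_right 2), (Rabs_right (b + INR n)), (Rabs_right (INR n + 1)) in H by lra.
    assert (Han : Cmod (a + RtoC (INR n)) <= K * (b + INR n)).
    { eapply Rle_trans; [apply Cmod_triangle|]. rewrite Cmod_R, Rabs_right by lra.
      replace (K * (b + INR n)) with (Cmod a + INR n + (Cmod a / b * INR n + b))
        by (unfold K; field; lra).
      assert (0 <= Cmod a / b * INR n) by (apply Rmult_le_pos; assumption). lra. }
    set (c := Cmod (kummer_coef L eta n)) in *.
    set (c' := Cmod (kummer_coef L eta (S n))) in *.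
    assert (Hc : 0 <= c) by apply Cmod_ge_0.
    assert (H' : c' * (INR n + 1) <= c * (2 * K)).
    { apply Rmult_le_reg_r with (b + INR n); [lra|].
      assert (c * Cmod (a + RtoC (INR n)) <= c * (K * (b + INR n)))
        by (apply Rmult_le_compat_l; assumption). lra. }
    change (fact (S n)) with (S n * fact n)%nat. rewrite mult_INR, S_INR.
    assert (Hf := INR_fact_lt_0 n).
    apply Rmult_le_reg_r with (INR n + 1); [lra|].
    eapply Rle_trans; [exact H'|].
    replace ((2 * K) ^ S n / ((INR n + 1) * INR (fact n)) * (INR n + 1))
      with ((2 * K) ^ n / INR (fact n) * (2 * K)) by (simpl; field; lra).
    apply Rmult_le_compat_r; [unfold K; lra|exact IH].
Qed.

Lemma pow_div_fact_le_exp (x : R) (n : nat) : 0 <= x -> x ^ n / INR (fact n) <= exp x.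
Proof.
  intros Hx. eapply Rle_trans; [|apply (exp_ge_taylor x n Hx)].
  assert (Ht : forall k, 0 <= x ^ k / INR (fact k)).
  { intros k. apply Rmult_le_pos; [apply pow_le, Hx|].
    apply Rlt_le, Rinv_0_lt_compat, INR_fact_lt_0. }
  destruct n as [|n]; [simpl; lra|]. rewrite tech5.
  assert (0 <= sum_f_R0 (fun k => x ^ k / INR (fact k)) n) by (apply cond_pos_sum, Ht).
  lra.
Qed.

Lemma CV_radius_infinite_of_fact_bound (a : nat -> R) (K : R) : 0 <= K ->
  (forall n, Rabs (a n) <= K ^ n / INR (fact n)) -> CV_radius a = p_infty.
Proof.
  intros HK Ha.
  assert (Hub : forall r : R, Rbar_le r (CV_radius a)).
  { intros r. apply (proj1 (CV_radius_bounded a)).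
    exists (exp (K * Rabs r)). intros n.
    eapply Rle_trans;
      [|apply (pow_div_fact_le_exp _ n), Rmult_le_pos; [exact HK|apply Rabs_pos]].
    rewrite Rabs_mult, <- RPow_abs, Rpow_mult_distr.
    replace (K ^ n * Rabs r ^ n / INR (fact n)) with (K ^ n / INR (fact n) * Rabs r ^ n)
      by (unfold Rdiv; ring).
    apply Rmult_le_compat_r; [apply pow_le, Rabs_pos|apply Ha]. }
  destruct (CV_radius a) as [r| |]; [|reflexivity|].
  - specialize (Hub (r + 1)). simpl in Hub. lra.
  - specialize (Hub 0). destruct Hub.
Qed.

Lemma is_pseries_PSeries (a : nat -> R) (x : R) :
  CV_radius a = p_infty -> is_pseries a x (PSeries a x).
Proof.
  intros Ha. apply PSeries_correct, CV_radius_inside. now rewrite Ha.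
Qed.

Lemma is_pseries_lin (a b c : nat -> R) (al be ga x A B D : R) :
  is_pseries a x A -> is_pseries b x B -> is_pseries c x D ->
  is_pseries (fun n => al * a n + be * b n + ga * PS_incr_1 c n) x
             (al * A + be * B + ga * (x * D)).
Proof.
  intros Ha Hb Hc.
  apply (is_pseries_scal al) in Ha; [|apply Rmult_comm].
  apply (is_pseries_scal be) in Hb; [|apply Rmult_comm].
  apply is_pseries_incr_1 in Hc. apply (is_pseries_scal ga) in Hc; [|apply Rmult_comm].
  exact (is_pseries_plus _ _ _ _ _ (is_pseries_plus _ _ _ _ _ Ha Hb) Hc).
Qed.

(** Real and imaginary parts of 1F1(L+1 - i eta, 2L+2; 2 i rho), as real power
    series in [rho]. *)
Definition kummer_re (L eta : R) : R -> R := PSeries (fun n => Re (kummer_coef L eta n)).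
Definition kummer_im (L eta : R) : R -> R := PSeries (fun n => Im (kummer_coef L eta n)).

Lemma kummer_radius (L eta : R) : -1 < L ->
  CV_radius (fun n => Re (kummer_coef L eta n)) = p_infty /\
  CV_radius (fun n => Im (kummer_coef L eta n)) = p_infty.
Proof.
  intros HL. destruct (kummer_coef_bound L eta HL) as [K [HK Hb]].
  split; apply (CV_radius_infinite_of_fact_bound _ K HK); intros n.
  - eapply Rle_trans; [apply re_le_Cmod|apply Hb].
  - eapply Rle_trans; [apply im_le_Cmod|apply Hb].
Qed.

Lemma hyp1F1_kummer (L eta rho : R) :
  hyp1F1 (RtoC (L + 1) - Ci * RtoC eta) (RtoC (2 * L + 2)) (RtoC 2 * Ci * RtoC rho)
  = (kummer_re L eta rho, kummer_im L eta rho).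
Proof.
  assert (H : forall n, (Cpoch (RtoC (L + 1) - Ci * RtoC eta) n
      / Cpoch (RtoC (2 * L + 2)) n * (RtoC 2 * Ci * RtoC rho) ^ n / RtoC (INR (fact n))
      = kummer_coef L eta n * RtoC (rho ^ n))%C).
  { intros n. rewrite Cpow_mult_l, RtoC_pow. unfold kummer_coef, Cdiv. ring. }
  unfold hyp1F1, CSeries, kummer_re, kummer_im, PSeries.
  f_equal; apply Series_ext; intros n; rewrite H; [apply re_scal_r|apply im_scal_r].
Qed.

(** * The normalized Coulomb function *)

(** Real part of [exp (- i rho) * 1F1(L+1 - i eta, 2L+2; 2 i rho)]: the normalized
    Coulomb function, extended to all real [rho]. *)
Definition coulomb_entire (L eta rho : R) : R :=
  cos rho * kummer_re L eta rho + sin rho * kummer_im L eta rho.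

Lemma coulombF_entire (L eta rho : R) :
  coulombF L eta rho = coulombC L eta * Rpower rho (L + 1) * coulomb_entire L eta rho.
Proof.
  unfold coulombF. rewrite hyp1F1_kummer. unfold Cexp, coulomb_entire; simpl.
  replace (- (0) * rho - - (1) * 0) with 0 by ring.
  replace (- (0) * 0 + - (1) * rho) with (- rho) by ring.
  rewrite exp_0, cos_neg, sin_neg. ring.
Qed.

Lemma coulombFn_entire (L eta rho : R) : -1 < L -> 0 < rho ->
  coulombFn L eta rho = coulomb_entire L eta rho.
Proof.
  intros HL Hrho. unfold coulombFn. rewrite coulombF_entire.
  assert (HC := coulombC_neq_0 L eta HL).
  replace (- L - 1) with (- (L + 1)) by ring. rewrite Rpower_Ropp.
  assert (0 < Rpower rho (L + 1)) by apply exp_pos. field. lra.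
Qed.

Lemma coulomb_entire_0 (L eta : R) : coulomb_entire L eta 0 = 1.
Proof.
  unfold coulomb_entire, kummer_re. rewrite PSeries_0, kummer_coef_0, cos_0, sin_0.
  simpl. ring.
Qed.

Lemma is_derive_kummer (L eta rho : R) : -1 < L ->
  let k := eta / (L + 1) in
  let c := (1 + k ^ 2) / (2 * L + 3) in
  is_derive (kummer_re L eta) rho
    (k * kummer_re L eta rho - kummer_im L eta rho - c * rho * kummer_re (L + 1) eta rho)
  /\ is_derive (kummer_im L eta) rho
    (k * kummer_im L eta rho + kummer_re L eta rho - c * rho * kummer_im (L + 1) eta rho).
Proof.
  intros HL k c.
  destruct (kummer_radius L eta HL) as [Hp Hq].
  destruct (kummer_radius (L + 1) eta ltac:(lra)) as [Hp' Hq'].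
  apply (is_pseries_PSeries _ rho) in Hp' as Sp', Hq' as Sq', Hp as Sp, Hq as Sq.
  assert (H0 : kummer_coef L eta 1 = (RtoC k + Ci)%C).
  { assert (H := kummer_coef_S L eta 0 HL). rewrite kummer_coef_0 in H. simpl INR in H.
    apply Cmult_reg_r with (RtoC (2 * L + 2)); [apply RtoC_neq_0; lra|].
    transitivity (kummer_coef L eta 1 * ((RtoC (2 * L + 2) + 0) * (0 + RtoC 1)))%C; [ring|].
    rewrite H. unfold k. apply injective_projections; simpl; field; lra. }
  assert (Hrel := fun n => kummer_coef_rel_lower L eta n HL). fold k in Hrel. fold c in Hrel.
  split.
  - replace (k * _ - _ - _) with (PSeries (PS_derive (fun n => Re (kummer_coef L eta n))) rho).
    { apply is_derive_PSeries. now rewrite Hp. }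
    apply is_pseries_unique.
    replace (k * _ - _ - _) with
     (k * kummer_re L eta rho + -1 * kummer_im L eta rho + - c * (rho * kummer_re (L + 1) eta rho))
     by ring.
    eapply is_pseries_ext; [|apply (is_pseries_lin _ _ _ k (-1) (- c) _ _ _ _ Sp Sq Sp')].
    intros [|n]; unfold PS_derive.
    + rewrite H0, kummer_coef_0. simpl. unfold zero; simpl. ring.
    + assert (H := f_equal Re (Hrel n)). rewrite !S_INR. simpl in *. lra.
  - replace (k * _ + _ - _) with (PSeries (PS_derive (fun n => Im (kummer_coef L eta n))) rho).
    { apply is_derive_PSeries. now rewrite Hq. }
    apply is_pseries_unique.
    replace (k * _ + _ - _) with
     (k * kummer_im L eta rho + 1 * kummer_re L eta rho + - c * (rho * kummer_im (L + 1) eta rho))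
     by ring.
    eapply is_pseries_ext; [|apply (is_pseries_lin _ _ _ k 1 (- c) _ _ _ _ Sq Sp Sq')].
    intros [|n]; unfold PS_derive.
    + rewrite H0, kummer_coef_0. simpl. unfold zero; simpl. ring.
    + assert (H := f_equal Im (Hrel n)). rewrite !S_INR. simpl in *. lra.
Qed.

Lemma Derive_kummer_raise (L eta rho : R) : -1 < L ->
  let k := eta / (L + 1) in
  let m := 2 * L + 3 in
  rho * Derive (kummer_re (L + 1) eta) rho
    = m * (kummer_re L eta rho - kummer_re (L + 1) eta rho)
      - rho * kummer_im (L + 1) eta rho - k * rho * kummer_re (L + 1) eta rho
  /\ rho * Derive (kummer_im (L + 1) eta) rho
    = m * (kummer_im L eta rho - kummer_im (L + 1) eta rho)
      + rho * kummer_re (L + 1) eta rho - k * rho * kummer_im (L + 1) eta rho.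
Proof.
  intros HL k m.
  destruct (kummer_radius L eta HL) as [Hp Hq].
  destruct (kummer_radius (L + 1) eta ltac:(lra)) as [Hp' Hq'].
  apply (is_pseries_PSeries _ rho) in Hp' as Sp', Hq' as Sq', Hp as Sp, Hq as Sq.
  assert (Hrel := fun n => kummer_coef_rel_raise L eta n HL). fold k in Hrel. fold m in Hrel.
  split.
  - unfold kummer_re at 1. rewrite Derive_PSeries by now rewrite Hp'.
    rewrite <- PSeries_incr_1. apply is_pseries_unique.
    assert (S1 := is_pseries_lin _ _ _ (-1) (- k) 0 _ _ _ _ Sq' Sp' Sp').
    assert (S2 := is_pseries_lin _ _ _ m (- m) 1 _ _ _ _ Sp Sp' S1).
    replace (m * (_ - _) - _ - _) with
      (m * kummer_re L eta rho + - m * kummer_re (L + 1) eta rho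
       + 1 * (rho * (-1 * kummer_im (L + 1) eta rho + - k * kummer_re (L + 1) eta rho
                     + 0 * (rho * kummer_re (L + 1) eta rho)))) by ring.
    eapply is_pseries_ext; [|exact S2].
    intros [|n]; unfold PS_derive.
    + rewrite !kummer_coef_0. simpl. unfold zero; simpl. ring.
    + assert (H := Hrel n). revert H. unfold PS_incr_1. rewrite !S_INR.
      generalize (kummer_coef L eta (S n)) (kummer_coef (L + 1) eta (S n))
        (kummer_coef (L + 1) eta n).
      intros [a1 a2] [b1 b2] [c1 c2] H. apply (f_equal Re) in H. simpl in *. lra.
  - unfold kummer_im at 1. rewrite Derive_PSeries by now rewrite Hq'.
    rewrite <- PSeries_incr_1. apply is_pseries_unique.
    assert (S1 := is_pseries_lin _ _ _ 1 (- k) 0 _ _ _ _ Sp' Sq' Sp').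
    assert (S2 := is_pseries_lin _ _ _ m (- m) 1 _ _ _ _ Sq Sq' S1).
    replace (m * (_ - _) + _ - _) with
      (m * kummer_im L eta rho + - m * kummer_im (L + 1) eta rho
       + 1 * (rho * (1 * kummer_re (L + 1) eta rho + - k * kummer_im (L + 1) eta rho
                     + 0 * (rho * kummer_re (L + 1) eta rho)))) by ring.
    eapply is_pseries_ext; [|exact S2].
    intros [|n]; unfold PS_derive.
    + rewrite !kummer_coef_0. simpl. unfold zero; simpl. ring.
    + assert (H := Hrel n). revert H. unfold PS_incr_1. rewrite !S_INR.
      generalize (kummer_coef L eta (S n)) (kummer_coef (L + 1) eta (S n))
        (kummer_coef (L + 1) eta n).
      intros [a1 a2] [b1 b2] [c1 c2] H. apply (f_equal Im) in H. simpl in *. lra.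
Qed.

Lemma is_derive_coulomb_lower (L eta rho : R) : -1 < L ->
  let k := eta / (L + 1) in
  is_derive (coulomb_entire L eta) rho
    (k * coulomb_entire L eta rho
     - (1 + k ^ 2) / (2 * L + 3) * rho * coulomb_entire (L + 1) eta rho).
Proof.
  intros HL k. destruct (is_derive_kummer L eta rho HL) as [Hp Hq].
  fold k in Hp, Hq. unfold coulomb_entire. auto_derive.
  - repeat split; auto; eexists; first [exact Hp | exact Hq].
  - rewrite (is_derive_unique _ _ _ Hp : Derive (fun x => kummer_re L eta x) rho = _).
    rewrite (is_derive_unique _ _ _ Hq : Derive (fun x => kummer_im L eta x) rho = _).
    ring.
Qed.

Lemma Derive_coulomb_raise (L eta rho : R) : -1 < L ->
  let k := eta / (L + 1) in
  rho * Derive (coulomb_entire (L + 1) eta) rho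
  = (2 * L + 3) * (coulomb_entire L eta rho - coulomb_entire (L + 1) eta rho)
    - k * rho * coulomb_entire (L + 1) eta rho.
Proof.
  intros HL k. destruct (is_derive_kummer (L + 1) eta rho ltac:(lra)) as [Hp Hq].
  destruct (Derive_kummer_raise L eta rho HL) as [Rp Rq]. fold k in Rp, Rq.
  rewrite (is_derive_unique _ _ _ Hp) in Rp. rewrite (is_derive_unique _ _ _ Hq) in Rq.
  match type of Hp with is_derive _ _ ?l => set (dp := l) in * end.
  match type of Hq with is_derive _ _ ?l => set (dq := l) in * end.
  assert (Hd : is_derive (coulomb_entire (L + 1) eta) rho
     (- sin rho * kummer_re (L + 1) eta rho + cos rho * dp
      + (cos rho * kummer_im (L + 1) eta rho + sin rho * dq))).
  { unfold coulomb_entire. auto_derive.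
    - repeat split; auto; eexists; first [exact Hp | exact Hq].
    - rewrite (is_derive_unique _ _ _ Hp : Derive (fun x => kummer_re (L + 1) eta x) rho = _).
      rewrite (is_derive_unique _ _ _ Hq : Derive (fun x => kummer_im (L + 1) eta x) rho = _).
      ring. }
  rewrite (is_derive_unique _ _ _ Hd). unfold coulomb_entire.
  transitivity (rho * (cos rho * kummer_im (L + 1) eta rho - sin rho * kummer_re (L + 1) eta rho)
     + cos rho * (rho * dp) + sin rho * (rho * dq)); [ring|].
  rewrite Rp, Rq. ring.
Qed.

(** The value at 0 is 1, and a zero in (0, x1) would be a zero of [coulombF]. *)
Lemma coulomb_entire_pos (L eta x1 rho : R) : -1 < L ->
  smallest_positive_zero (fun r => coulombF L eta r) x1 ->
  0 <= rho < x1 -> 0 < coulomb_entire L eta rho.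
Proof.
  intros HL [_ [_ Hz]] Hrho.
  destruct (Rlt_or_le 0 (coulomb_entire L eta rho)) as [|Hneg]; [assumption|exfalso].
  assert (Hr0 : 0 < rho).
  { destruct (proj1 Hrho) as [|H]; [assumption|].
    subst rho. rewrite coulomb_entire_0 in Hneg. lra. }
  destruct (IVT_gen (coulomb_entire L eta) 0 rho 0) as [y [Hy Hy0]].
  - intros y. apply derivable_continuous_pt. eexists.
    apply is_derive_Reals, is_derive_coulomb_lower, HL.
  - rewrite coulomb_entire_0. rewrite Rmin_right, Rmax_left; lra.
  - rewrite Rmin_left, Rmax_right in Hy by lra.
    destruct (proj1 Hy) as [Hpos|H].
    + assert (H := Hz y Hpos). rewrite coulombF_entire, Hy0, Rmult_0_r in H.
      specialize (H eq_refl). lra.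
    + subst y. rewrite coulomb_entire_0 in Hy0. lra.
Qed.

Theorem theorem3 (L eta x1 rho : R)
  (heta : eta <= 0) (hL : -1 < L)
  (hx1 : smallest_positive_zero (fun r : R => coulombF L eta r) x1)
  (hrho0 : 0 < rho) (hrho1 : rho < x1) :
  Rpower (coulombFn L eta rho) (L + 3 / 2)
    < Rpower (coulombFn (L + 1) eta rho) (L + 5 / 2)
  /\ Rpower (coulombFn (L + 1) eta rho) (1 / (L + 3 / 2))
     + coulombFn (L + 1) eta rho / coulombFn L eta rho >= 2.
Proof.
  rewrite !coulombFn_entire by lra.
  set (k := eta / (L + 1)). set (m := 2 * L + 3).
  assert (Hk : k <= 0).
  { unfold k, Rdiv. assert (0 < / (L + 1)) by (apply Rinv_0_lt_compat; lra). nra. }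
  assert (Hgpos : forall x, 0 <= x <= rho -> 0 < coulomb_entire L eta x).
  { intros x Hx. apply coulomb_entire_pos with x1; [exact hL|exact hx1|lra]. }
  destruct (contiguous_log_ineq k m rho (coulomb_entire L eta) (coulomb_entire (L + 1) eta)
              (Derive (coulomb_entire (L + 1) eta))) as [Hh Hln].
  - exact Hk.
  - unfold m; lra.
  - exact hrho0.
  - apply coulomb_entire_0.
  - intros x. apply is_derive_coulomb_lower, hL.
  - intros x. apply Derive_correct. eexists. apply is_derive_coulomb_lower. lra.
  - intros x. apply Derive_coulomb_raise, hL.
  - exact Hgpos.
  - assert (Hg : 0 < coulomb_entire L eta rho) by (apply Hgpos; lra).
    set (g := coulomb_entire L eta rho) in *. set (h := coulomb_entire (L + 1) eta rho) in *.
    split.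
    + unfold Rpower. apply exp_increasing. unfold m in Hln. lra.
    (* The two terms are exp u and exp v with u + v > 0, and exp t >= 1 + t. *)
    + replace (h / g) with (exp (ln h - ln g))
        by (unfold Rminus; rewrite exp_plus, exp_Ropp, !exp_ln by assumption; reflexivity).
      unfold Rpower. set (u := 1 / (L + 3 / 2) * ln h). set (v := ln h - ln g).
      assert (Hu : 0 < u + v).
      { apply Rmult_lt_reg_l with m; [unfold m; lra|].
        replace (m * (u + v)) with ((m + 2) * ln h - m * ln g)
          by (unfold u, v, m; field; lra). lra. }
      assert (H1 := exp_ineq1_le u). assert (H2 := exp_ineq1_le v). lra.
Qed.
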